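(* Let $G$ be a finite abelian group with primary decomposition $G=G_1\times\cdots\times G_k$, where $p_1,\dots,p_k$ are the distinct primes dividing $|G|$ and, for each $i=1,\dots,k$, $G_i$ is the $p_i$-group $$G_i=\mathbb{Z}_{p_i^{\alpha_{i1}}}\times\cdots\times\mathbb{Z}_{p_i^{\alpha_{ir_i}}},\qquad r_i\ge 1,\quad 1\leq\alpha_{i1}\leq\cdots\leq\alpha_{ir_i}.$$ Then $$\prod_{i=1}^k\ \sum_{\substack{1\leq m_i\leq p_i^{\alpha_{ir_i}}\\ p_i\nmid m_i}}\ \prod_{j=1}^{r_i}\gcd(m_i-1,p_i^{\alpha_{ij}})=\varphi(\exp(G))\,|L_1(G)|.$$
   Context: $\mathbb{Z}_n=\mathbb{Z}/n\mathbb{Z}$ denotes the cyclic group of order $n$ (written additively). $\varphi$ is Euler's totient function, $\exp(G)$ is the exponent of $G$, and $|L_1(G)|$ is the number of cyclic subgroups of $G$ (including the trivial subgroup). The convention $\gcd(0,a)=a$ is used for positive integers $a$. *)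

(* Defs.v *)
From mathcomp Require Import all_boot all_fingroup all_solvable.

Set Implicit Arguments.
Unset Strict Implicit.
Unset Printing Implicit Defensive.

Definition cyclic_subgroups (gT : finGroupType) (G : {group gT}) :
  {set {group gT}} := [set C in subgroups G | cyclic C].

(* Main.v *)
Require Import Defs.
From mathcomp Require Import all_boot all_fingroup all_solvable all_algebra.

Set Implicit Arguments.
Unset Strict Implicit.
Unset Printing Implicit Defensive.

(** Let the units m modulo exp(G) act on G by x |-> x ^ m.  Two elements lie in
    the same orbit iff they generate the same cyclic subgroup, so there are
    |L_1(G)| orbits; and the fixed points of m are the solutions of
    x ^ (m - 1) = 1.  The identity is Burnside's orbit count for this action,
    with the average over units cleared of its denominator totient (exp G).

    The formula is easiest one prime at a time, where the orbit count is a
    plain double count ([sum_Ldiv_pgroup]).  In a p-group of exponent p ^ e,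
    exchange the two sums: an element x of order p ^ b is fixed by exactly the
    units modulo p ^ e that are 1 modulo p ^ b, and there are
    totient (p ^ e) / totient (p ^ b) of them ([totient_reduction_kernel]).
    Since a cyclic group of order p ^ b has totient (p ^ b) generators, every
    cyclic subgroup contributes totient (p ^ e) in total
    ([sum_order_cyclic_subgroups]).

    Two multiplicativity arguments turn this into the stated formula.  Within a
    primary factor, the number of solutions of x ^ n = 1 is multiplicative over
    direct products and equals gcd(n, N) in a cyclic group of order N
    ([card_Ldiv_dprod], [card_Ldiv_cyclic]); at m = 1 the exponent n is 0 and
    gcd(0, N) = N.  Across distinct primes, both totient (exp G) and |L_1(G)|
    are multiplicative over direct products of coprime orders
    ([totient_exponent_cyclic_dprod]). *)

(** * Invariants of iterated direct products *)

Lemma bigdprod_morph (gT : finGroupType) (F : {group gT} -> nat)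
    (idx : nat) (op : nat -> nat -> nat) (I : Type) (s : seq I)
    (A : I -> {group gT}) (G : {group gT}) :
    F 1%G = idx ->
    (forall K H L : {group gT}, (K \x H)%g = L -> F L = op (F K) (F H)) ->
    \big[dprod/1%g]_(i <- s) A i = G ->
  F G = \big[op/idx]_(i <- s) F (A i).
Proof.
move=> F1 FM; elim: s G => [|i s IHs] G.
  by rewrite !big_nil => /group_inj <-.
rewrite !big_cons => defG; have [[_ H _ defH] _ _ _] := dprodP defG.
by rewrite -(IHs H defH); apply: FM; rewrite -defH.
Qed.

(** An invariant such as the number of cyclic subgroups is multiplicative only
    on coprime factors; uniqueness of the indices is what makes the head of the
    list coprime to the product of its tail. *)
Lemma bigdprod_coprime_mul (gT : finGroupType) (F : {group gT} -> nat)
    (I : eqType) (s : seq I) (A : I -> {group gT}) (G : {group gT}) :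
    F 1%G = 1 ->
    (forall K H L : {group gT}, (K \x H)%g = L -> coprime #|K| #|H| ->
       F L = F K * F H) ->
    {in s &, forall i j, i != j -> coprime #|A i| #|A j|} -> uniq s ->
    \big[dprod/1%g]_(i <- s) A i = G ->
  F G = \prod_(i <- s) F (A i).
Proof.
move=> F1 FM; elim: s G => [|i s IHs] G coA.
  by rewrite !big_nil => _ /group_inj <-.
case/andP=> s'i uniq_s.
rewrite !big_cons => defG; have [[_ H _ defH] _ _ _] := dprodP defG.
rewrite -(IHs H _ uniq_s defH); last first.
  by move=> j l sj sl; apply: coA; rewrite inE (sj, sl) orbT.
apply: FM; first by rewrite -defH.
rewrite -(bigdprod_card defH) big_seq_cond.
apply: (big_ind (coprime #|A i|)) => [|m n com con|j].
- exact: coprimen1.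
- by rewrite coprimeMr com.
rewrite andbT => sj; apply: coA; rewrite ?inE ?eqxx ?sj ?orbT //.
by apply: contraNneq s'i => ->.
Qed.

(** * Cyclic subgroups and solutions of x ^ n = 1 *)

Section CyclicSubgroups.

Variable gT : finGroupType.
Implicit Types K H G : {group gT}.

(** (D1, D2) |-> D1 * D2 is a bijection onto the cyclic subgroups of K \x H: a
    product of coprime cyclic groups is cyclic, a generator x * y yields the
    pair (<[x]>, <[y]>), and the modular law recovers D1 and D2 by intersecting
    the product with K and H. *)
Lemma card_cyclic_subgroups_dprod K H G :
    (K \x H)%g = G -> coprime #|K| #|H| ->
  #|cyclic_subgroups G| = #|cyclic_subgroups K| * #|cyclic_subgroups H|.
Proof.
case/dprodP=> _ defG cKH tiKH coKH; rewrite -cardsX.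
pose f (D : {group gT} * {group gT}) := (D.1 <*> D.2)%G.
have subX D : D \in setX (cyclic_subgroups K) (cyclic_subgroups H) ->
    [/\ D.1 \subset K, cyclic D.1, D.2 \subset H, cyclic D.2
      & (D.1 <*> D.2 = D.1 * D.2)%g].
  rewrite !inE => /andP[/andP[sK c1] /andP[sH c2]]; split=> //.
  by rewrite cent_joinEr // (subset_trans sH) // (subset_trans cKH) ?centS.
have factors L : L \in setX (cyclic_subgroups K) (cyclic_subgroups H) ->
    L.1 = (f L :&: K)%G /\ L.2 = (H :&: f L)%G.
  case/subX=> t1 _ t2 _ eL; split; apply: val_inj; rewrite /= eL.
    rewrite -group_modl //.
    have/trivgP->: L.2 :&: K \subset [1 gT]%g by rewrite -tiKH setIC setIS.
    by rewrite mulg1.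
  rewrite -group_modr //.
  have/trivgP->: H :&: L.1 \subset [1 gT]%g by rewrite -tiKH setIC setSI.
  by rewrite mul1g.
rewrite -(card_in_imset (f := f)) => [|D E XD XE eDE].
  apply: eq_card => L; apply/idP/imsetP=> [|[D /subX[s1 c1 s2 c2 eD] ->]].
    rewrite !inE => /andP[sLG /cyclicP[z eL]].
    have: z \in G by rewrite (subsetP sLG) // eL cycle_id.
    rewrite -defG => /mulsgP[x y Kx Hy def_z].
    exists (<[x]>%G, <[y]>%G).
      by rewrite !inE !cycle_subG Kx Hy !cycle_cyclic.
    apply: val_inj; rewrite /= eL def_z.
    have cxy: commute x y by apply/commute_sym/(centsP cKH).
    rewrite cent_joinEr; last by rewrite cent_cycle cycle_subG; apply/cent1P.
    by rewrite cycleM // (coprimegS _ (coprimeSg _ coKH)) ?cycle_subG.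
  rewrite !inE /= eD -defG mulgSS //=.
  rewrite cyclicM ?(coprimegS s2 (coprimeSg s1 coKH)) //.
  by rewrite (subset_trans s2) // (subset_trans cKH) ?centS.
have [eD1 eD2] := factors D XD; have [eE1 eE2] := factors E XE.
by rewrite [D]surjective_pairing [E]surjective_pairing eD1 eD2 eDE -eE1 -eE2.
Qed.

Lemma totient_exponent_cyclic_dprod K H G :
    (K \x H)%g = G -> coprime #|K| #|H| ->
  totient (exponent G) * #|cyclic_subgroups G| =
    (totient (exponent K) * #|cyclic_subgroups K|)
    * (totient (exponent H) * #|cyclic_subgroups H|).
Proof.
move=> defG coKH; rewrite (card_cyclic_subgroups_dprod defG coKH).
rewrite -(dprod_exponent defG).
have coE: coprime (exponent K) (exponent H).
  by apply: coprime_dvdl (exponent_dvdn K) (coprime_dvdr (exponent_dvdn H) _).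
have := muln_lcm_gcd (exponent K) (exponent H).
by rewrite (eqP coE) muln1 => ->; rewrite totient_coprime // mulnACA.
Qed.

(** Group the elements by the cyclic subgroup that they generate: D has
    totient #|D| generators, all of order #|D|. *)
Lemma sum_order_cyclic_subgroups G (f : nat -> nat) :
  \sum_(x in G) f #[x]%g
    = \sum_(D in cyclic_subgroups G) totient #|D| * f #|D|.
Proof.
rewrite (partition_big (fun x => <[x]>%G) (mem (cyclic_subgroups G))) /=;
  last by move=> x Gx; rewrite !inE cycle_subG Gx cycle_cyclic.
apply: eq_bigr => D; rewrite !inE => /andP[sDG /cyclicP[g defD]].
rewrite {1}defD [totient _]totient_gen -sum1_card big_distrl /=.
apply: eq_big => [x|x /andP[_ /eqP<-]]; last by rewrite mul1n.
rewrite inE /generator -defD -val_eqE /= [RHS]eq_sym andb_idl // => /eqP eD.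
by rewrite (subsetP sDG) // -eD cycle_id.
Qed.

Lemma card_Ldiv_dprod n K H G :
  (K \x H)%g = G -> #|'Ldiv_n(G)%g| = #|'Ldiv_n(K)%g| * #|'Ldiv_n(H)%g|.
Proof.
move=> defG; have [_ mulKH cKH tiKH] := dprodP defG.
have expM x y : x \in K -> y \in H -> ((x * y) ^+ n = x ^+ n * y ^+ n)%g.
  by move=> Kx Hy; rewrite expgMn //; apply/commute_sym/(centsP cKH).
rewrite -cardsX -(card_in_imset (f := fun u : gT * gT => (u.1 * u.2)%g)).
  apply: eq_card => z; apply/idP/imsetP=> [|[[x y]]].
    case/setIP => /(mem_dprod defG)[x [y [Kx Hy -> _]]]; rewrite inE expM //.
    move=> xyn1; exists (x, y) => //=.
    have xn1: (x ^+ n = 1)%g.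
      apply/set1gP; rewrite -tiKH inE groupX //=.
      by move: xyn1; rewrite -eq_invg_mul => /eqP yE; rewrite -groupV yE groupX.
    by rewrite !inE Kx Hy /= xn1 -(eqP xyn1) xn1 mul1g !eqxx.
  rewrite !inE /= => /andP[/andP[Kx /eqP xn] /andP[Hy /eqP yn]] ->.
  by rewrite -mulKH mem_mulg //= expM // xn yn mulg1.
move=> [x y] [x' y']; rewrite !inE /=.
case/andP=> /andP[Kx _] /andP[Hy _] /andP[/andP[Kx' _] /andP[Hy' _]] exy.
have Gxy: (x * y \in G)%g by rewrite -mulKH mem_mulg.
have [u [v [_ _ _ uniq_uv]]] := mem_dprod defG Gxy.
have [-> ->] := uniq_uv x y Kx Hy erefl.
by have [-> ->] := uniq_uv _ _ Kx' Hy' exy.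
Qed.

(** With d = gcd(n, #|G|), the solutions of x ^ n = 1 are the elements whose
    order divides d; in a cyclic group these form the subgroup of order d. *)
Lemma card_Ldiv_cyclic n G : cyclic G -> #|'Ldiv_n(G)%g| = gcdn n #|G|.
Proof.
move=> cycG; have /cyclicP[g defG] := cycG.
set d := gcdn n #|G|.
have dG: d %| #|G| by apply: dvdn_gcdr.
have d_gt0: 0 < d by rewrite gcdn_gt0 cardG_gt0 orbT.
pose h := (g ^+ (#|G| %/ d))%g.
have oh: #[h]%g = d.
  rewrite orderXdiv; first rewrite /order -defG.
    by rewrite -{1}(divnK dG) mulKn // divn_gt0 // dvdn_leq.
  by rewrite /order -defG dvdn_div.
have Gh: h \in G by rewrite groupX // defG cycle_id.
rewrite -oh; apply: eq_card => x; rewrite !inE -order_dvdn.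
apply/andP/idP=> [[Gx xn]|hx].
  rewrite -cycle_subG -(cardSg_cyclic cycG) ?cycle_subG //.
  by rewrite -/(order x) -/(order h) oh dvdn_gcd xn order_dvdG.
split; first by rewrite (subsetP _ _ hx) ?cycle_subG.
by rewrite (dvdn_trans (order_dvdG hx)) // -/(order h) oh dvdn_gcdl.
Qed.

End CyclicSubgroups.

(** * The p-group case *)

Lemma sum_nat_shift1 (f : nat -> nat) n :
  f 0 = f n -> \sum_(1 <= m < n.+1) f m = \sum_(0 <= m < n) f m.
Proof.
case: n => [|n] f0; first by rewrite !big_geq.
by rewrite big_nat_recr //= [RHS]big_ltn // addnC f0.
Qed.

(** The sum counts the kernel of the reduction of units modulo p ^ e to units
    modulo p ^ b.  If b > 0, every m that is 1 modulo p ^ b is already prime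
    to p, so the kernel has p ^ (e - b) elements; if b = 0, it is the whole
    group of units. *)
Lemma totient_reduction_kernel p e b : prime p -> b <= e ->
  totient (p ^ b)
    * (\sum_(1 <= m < (p ^ e).+1) (~~ (p %| m) && (p ^ b %| m - 1)))
    = totient (p ^ e).
Proof.
move=> pr_p; case: b => [_|b le_be].
  rewrite expn0 (_ : totient 1 = 1) // mul1n totient_count_coprime.
  (* For e = 0 the range cannot be shifted: m = 1 is counted, m = 0 is not. *)
  case: e => [|e].
    by rewrite expn0 !big_nat1 dvdn1 gtn_eqF ?prime_gt1.
  rewrite (sum_nat_shift1 (f := fun m => ~~ (p %| m) && (1 %| m - 1) : nat)).
    by apply: eq_bigr => m _; rewrite dvd1n andbT coprime_pexpl // prime_coprime.
  by rewrite dvdn0 expnS dvdn_mulr.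
rewrite big_add1 /= (eq_bigr (fun m => (p ^ b.+1 %| m) : nat)) => [|m _].
  rewrite -sum_nat_shift1 ?dvdn0 ?dvdn_exp2l // -divn_count_dvd -expnB ?prime_gt0 //.
  rewrite !totient_pfactor // ?(leq_trans _ le_be) // -mulnA -expnD.
  by case: e le_be => // e le_be; rewrite subSS subnKC.
rewrite subn1 /= andb_idl // => dv; rewrite -addn1 dvdn_addr ?Euclid_dvd1 //.
by apply: dvdn_trans dv; rewrite expnS dvdn_mulr.
Qed.

(** Burnside's orbit count for the units modulo exp(G) acting on a p-group by
    powers, as a double count of the pairs (m, x) with x ^ (m - 1) = 1. *)
Lemma sum_Ldiv_pgroup p (gT : finGroupType) (G : {group gT}) :
    prime p -> p.-group%g G ->
  \sum_(1 <= m < (exponent G).+1 | ~~ (p %| m)) #|'Ldiv_(m - 1)(G)%g|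
    = totient (exponent G) * #|cyclic_subgroups G|.
Proof.
move=> pr_p pG; have [e def_e]: {e | exponent G = p ^ e}.
  by apply/p_natP; rewrite ?pnat_exponent.
(* Number of units m that fix a given element of order d. *)
pose fixers d :=
  \sum_(1 <= m < (exponent G).+1) (~~ (p %| m) && (d %| m - 1) : nat).
transitivity (\sum_(x in G) fixers #[x]%g).
  rewrite exchange_big big_mkcond /=; apply: eq_bigr => m _.
  case: ifP => _ /=; last by rewrite big1.
  rewrite -sum1_card (eq_bigl (fun x => (x \in G) && (#[x]%g %| m - 1))).
    by rewrite big_mkcondr; apply: eq_bigr => x _; case: ifP.
  by move=> x; rewrite !inE order_dvdn.
rewrite sum_order_cyclic_subgroups mulnC -sum_nat_const.
apply: eq_bigr => D; rewrite !inE => /andP[sDG /cyclicP[x defD]].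
have: #|D| %| p ^ e.
  by rewrite -def_e defD dvdn_exponent // -cycle_subG -defD.
case/(dvdn_pfactor _ _ pr_p) => b le_be ->.
by rewrite /fixers def_e totient_reduction_kernel.
Qed.

(** * Abelian groups from their primary decomposition *)

Lemma exponent_bigdprod_chain (gT : finGroupType) (C : nat -> {group gT})
    (G : {group gT}) n :
    (forall j, 1 <= j <= n -> exponent (C j) %| exponent (C n.+1)) ->
    \big[dprod/1%g]_(1 <= j < n.+2) C j = G ->
  exponent G = exponent (C n.+1).
Proof.
move=> dvC defG.
rewrite (@bigdprod_morph _ (fun G => exponent G) 1 lcmn _ _ _ _ _ _ defG);
  last first.
- by move=> K H L /dprod_exponent.
- exact: exponent1.
rewrite big_nat_recr //=; apply/lcmn_idPr; rewrite big_nat.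
apply: (big_ind (dvdn^~ _)) => // m l dm dl.
by rewrite dvdn_lcm dm.
Qed.

Theorem theorem1 (gT : finGroupType) (G : {group gT})
    (k : nat) (p r : 'I_k -> nat) (alpha : 'I_k -> nat -> nat)
    (Gi : 'I_k -> {group gT}) (C : 'I_k -> nat -> {group gT})
    (abelG : abelian G)
    (p_inj : injective p)
    (p_primes : forall q : nat,
       prime q && (q %| #|G|) <-> exists i : 'I_k, q = p i)
    (defG : \big[dprod/1%g]_(i < k) Gi i = G)
    (r_ge1 : forall i, 1 <= r i)
    (alpha_ge1 : forall i j, 1 <= j <= r i -> 1 <= alpha i j)
    (alpha_mono : forall i j, 1 <= j < r i -> alpha i j <= alpha i j.+1)
    (defGi : forall i, \big[dprod/1%g]_(1 <= j < (r i).+1) C i j = Gi i)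
    (isoC : forall i j, 1 <= j <= r i -> C i j \isog Zp (p i ^ alpha i j)) :
  \prod_(i < k)
    \sum_(1 <= m < (p i ^ alpha i (r i)).+1 | ~~ (p i %| m))
      \prod_(1 <= j < (r i).+1) gcdn (m - 1) (p i ^ alpha i j)
  = totient (exponent G) * #|cyclic_subgroups G|.
Proof.
have pr_p i: prime (p i).
  by have /andP[]: prime (p i) && (p i %| #|G|) by apply/p_primes; exists i.
have cardC i j: 1 <= j <= r i -> #|C i j| = p i ^ alpha i j.
  by move=> /isoC/card_isog->; rewrite card_Zp // expn_gt0 prime_gt0.
have cycC i j: 1 <= j <= r i -> cyclic (C i j).
  move=> jr; rewrite (isog_cyclic (isoC i j jr)).
  rewrite /= /Zp; case: ifP => _; last exact: cyclic1.
  by apply/cyclicP; exists Zp1; apply: Zp_cycle.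
have pGi i: (p i).-group%g (Gi i).
  rewrite /pgroup -(bigdprod_card (defGi i)) big_nat.
  apply: (big_ind (pnat (p i))) => // [m n pm pn | j jr]; first by rewrite pnatM pm.
  by rewrite cardC // pnatX pnat_id.
have mono i j l: 1 <= j -> j <= l -> l <= r i -> alpha i j <= alpha i l.
  move=> j_gt0; elim: l => [|l IHl]; first by rewrite leqn0 => /eqP ->.
  rewrite leq_eqVlt => /predU1P[-> //|]; rewrite ltnS => le_jl lt_lr.
  by rewrite (leq_trans (IHl le_jl (ltnW lt_lr))) // alpha_mono // (leq_trans j_gt0).
have expC i j: 1 <= j <= r i -> exponent (C i j) = p i ^ alpha i j.
  by move=> jr; rewrite exponent_cyclic ?cycC ?cardC.
have expGi i: exponent (Gi i) = p i ^ alpha i (r i).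
  have r_gt0 := r_ge1 i; rewrite -expC ?r_gt0 ?leqnn // -(prednK r_gt0).
  apply: exponent_bigdprod_chain; last by rewrite prednK.
  move=> j /andP[j_gt0]; rewrite -ltnS prednK // => /ltnW le_jr.
  by rewrite !expC ?j_gt0 ?r_gt0 ?leqnn // dvdn_exp2l ?mono.
pose F (H : {group gT}) := totient (exponent H) * #|cyclic_subgroups H|.
transitivity (\prod_(i < k) F (Gi i)).
  apply: eq_bigr => i _.
  rewrite /F -(sum_Ldiv_pgroup (pr_p i) (pGi i)) expGi.
  apply: eq_bigr => m _.
  rewrite (@bigdprod_morph _ (fun H => #|'Ldiv_(m - 1)(H)%g|) 1 muln
             _ _ _ _ _ _ (defGi i)).
  - by apply: eq_big_nat => j jr; rewrite card_Ldiv_cyclic ?cycC ?cardC.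
  - by rewrite card_Ldiv_cyclic ?cyclic1 // cards1 gcdn1.
  - by move=> K H L; apply: card_Ldiv_dprod.
symmetry; apply: (bigdprod_coprime_mul (F := F)) defG.
- rewrite /F exponent1 mul1n; apply/eqP/cards1P; exists 1%G.
  apply/setP=> H; rewrite !inE subG1.
  by apply/andP/eqP=> [[/eqP/group_inj->]|->] //; rewrite eqxx cyclic1.
- exact: totient_exponent_cyclic_dprod.
- move=> i j _ _ neq_ij; apply: pnat_coprime (pGi i) _.
  rewrite -/(pgroup _ _).
  apply: sub_in_pnat (pGi j) => q _; rewrite !inE => /eqP->.
  by apply: contraNneq neq_ij => /p_inj->.
- exact: index_enum_uniq.
Qed.
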